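(* Let $\Omega$ be an infinite compact Hausdorff space and $X$ a (real or complex) Banach space. Let $\Lambda\in C(\Omega,X)^*_1$ be a w$^*$-w PC. Then $\Lambda=\sum_{i=1}^{\infty}\alpha_i\,\delta_{\omega_i}\otimes x_i^*$, where $\alpha_i\in(0,1]$ are such that $\sum_{i=1}^\infty\alpha_i=1$, $x_i^*\in X_1^*$ is a w$^*$-w PC (of $X_1^*$) for each $i\in\mathbb{N}$, and each $\omega_i\in\Omega$ is an isolated point of $\Omega$.
   Context: For a Banach space $Y$, $Y_1^*$ denotes the closed unit ball of $Y^*$. A point $y^*\in Y_1^*$ is called a w$^*$-w PC (weak$^*$-to-weak point of continuity) if the identity map $(Y_1^*,\text{weak}^* )\to(Y_1^*,\text{weak})$ is continuous at $y^*$, where weak$^*$ is the topology $\sigma(Y^*,Y)$ and weak is $\sigma(Y^*,Y^{**})$. $C(\Omega,X)$ is the Banach space of continuous functions $\Omega\to X$ with the supremum norm. For $\omega\in\Omega$ and $x^*\in X^*$, the functional $\delta_\omega\otimes x^*$ on $C(\Omega,X)$ is $(\delta_\omega\otimes x^* )(f)=x^*(f(\omega))$. The points $\omega_i$ are not required to be distinct. *)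

(* Defs.v *)
From HB Require Import structures.
From mathcomp Require Import all_boot all_order all_algebra.
From mathcomp Require Import all_classical all_reals all_analysis.
From mathcomp Require Import complex.

Set Implicit Arguments.
Unset Strict Implicit.
Unset Printing Implicit Defensive.

Import Order.TTheory GRing.Theory Num.Theory.
Import numFieldNormedType.Exports.

Local Open Scope classical_set_scope.
Local Open Scope ring_scope.

Inductive real_or_complex (R : realType) : numFieldType -> Prop :=
| Is_real : real_or_complex R R
| Is_complex : real_or_complex R R[i].

Record scalarField := ScalarField {
  scalar_base : realType;
  scalar_sort :> numFieldType;
  scalar_fieldP : real_or_complex scalar_base scalar_sort
}.

Lemma real_supremums (R : realType) (A : set R) :
  A !=set0 -> ubound A !=set0 -> supremums A !=set0.
Proof.
move=> A0 uA; exists (sup A); split; first by apply: sup_upper_bound.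
by move=> M AM; apply: ge_sup.
Qed.

Lemma complex_supremums (R : realType) (A : set R[i]) :
  A `<=` [set x | 0 <= x] -> A !=set0 -> ubound A !=set0 ->
  supremums A !=set0.
Proof.
move=> Age [a Aa] [M AM].
have [s [sub slub]] : supremums [set r | A r%:C%C] !=set0.
  apply: real_supremums.
    exists (complex.Re a) => /=; suff -> : (complex.Re a)%:C%C = a by [].
    by move: (Age _ Aa) => /=; case: (a) => x y; rewrite lecE /= => /andP[/eqP->].
  by exists (complex.Re M) => r /= /AM; rewrite lecE => /andP[].
exists s%:C%C; split.
  move=> [x y] Axy; move: (Age _ Axy) (Axy) => /=.
  rewrite lecE /= => /andP[/eqP-> _] Ax.
  by rewrite lecE /= eqxx /=; apply: sub.
move=> N AN; have := le_trans (Age _ Aa) (AN _ Aa); rewrite !lecE /=.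
move=> /andP[-> _] /=.
by apply: slub => r /= /AN; rewrite lecE => /andP[].
Qed.

Section supnorm.
Context (K : scalarField).

Lemma scalar_supremum (A : set K) : A `<=` [set x | 0 <= x] -> A !=set0 ->
  ubound A !=set0 -> supremums A (supremum 0 A).
Proof.
move=> Age A0 uA; rewrite /supremum; case: eqP => [A00|_].
  by move: A0; rewrite A00 => -[].
case: xgetP => [//|noA]; exfalso.
have [s /noA//] : supremums A !=set0.
case: K A {noA} Age A0 uA => R L; case.
  by move=> A _; exact: real_supremums.
exact: complex_supremums.
Qed.

Context (T : Type) (V : normedModType K).

(* The value is junk (namely 0) when f is unbounded on D.                     *)
Definition supnorm (D : set T) (f : T -> V) : K :=
  supremum 0 [set `|f t| | t in D].

Lemma supnormP (D : set T) (f : T -> V) (M : K) :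
  (forall t, D t -> `|f t| <= M) ->
  (forall t, D t -> `|f t| <= supnorm D f).
Proof.
move=> fM t Dt.
have [|||ub _] := @scalar_supremum [set `|f t| | t in D].
- by move=> _ /= [s _ <-].
- by exists `|f t|, t.
- by exists M => _ /= [s Ds <-]; exact: fM.
by apply: ub; exists t.
Qed.

Lemma supnorm_le (D : set T) (f : T -> V) (M : K) : 0 <= M ->
  (forall t, D t -> `|f t| <= M) -> supnorm D f <= M.
Proof.
move=> M0 fM; have [->|/set0P[t Dt]] := eqVneq D set0.
  by rewrite /supnorm image_set0 supremum0.
have [|||_] := @scalar_supremum [set `|f t| | t in D].
- by move=> _ /= [s _ <-].
- by exists `|f t|, t.
- by exists M => _ /= [s Ds <-]; exact: fM.
by apply => _ /= [s Ds <-]; exact: fM.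
Qed.

End supnorm.


(* Elements are the bounded (equivalently, continuous) linear functionals,    *)
(* with the operator norm.                                                    *)
Section dual.
Context (K : scalarField) (Y : normedModType K).

Definition dual_pred : {pred Y -> K^o} :=
  mem [set f : Y -> K^o | linear f /\ continuous f].

Record dual : Type := Dual {
  dual_fun :> Y -> K^o;
  dual_funP : dual_fun \in dual_pred
}.

HB.instance Definition _ := [isSub for dual_fun].
HB.instance Definition _ := [Choice of dual by <:].

Fact dual_submod_closed : submod_closed dual_pred.
Proof.
split.
  apply/mem_set; split; last exact: cst_continuous.
  by move=> a u v /=; rewrite scaler0 addr0.
move=> a f g /set_mem[lf cf] /set_mem[lg cg]; apply/mem_set; split.
  move=> b u v; rewrite /= !fctE lf lg !scalerDr !scalerA mulrC.
  by rewrite -!addrA; congr (_ + _); rewrite addrCA.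
by move=> u; exact: cvgD (cvgZl_tmp (k := a) (cf u)) (cg u).
Qed.
HB.instance Definition _ :=
  GRing.isSubmodClosed.Build K (Y -> K^o) dual_pred dual_submod_closed.
HB.instance Definition _ := [SubChoice_isSubLmodule of dual by <:].

Fact dual_linear (f : dual) : linear f.
Proof. by have /set_mem[] := dual_funP f. Qed.
HB.instance Definition _ (f : dual) :=
  GRing.isLinear.Build K Y K^o *:%R (dual_fun f) (dual_linear f).

Lemma dual_continuous (f : dual) : continuous f.
Proof. by have /set_mem[] := dual_funP f. Qed.

Definition dual_norm (f : dual) : K := supnorm [set y | `|y| <= 1] f.

Lemma dual_normP (f : dual) y : `|y| <= 1 -> `|f y| <= dual_norm f.
Proof.
have [_ /(_ (@dual_continuous f))/bounded_funP/(_ 1)[M fM]] :=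
  linear_bounded_continuous (f : {linear Y -> K^o}).
exact: (@supnormP K Y K^o [set y | `|y| <= 1] f M fM y).
Qed.

Fact dual_normD (f g : dual) : dual_norm (f + g) <= dual_norm f + dual_norm g.
Proof.
have y0 : `|0 : Y| <= 1 by rewrite normr0.
apply: supnorm_le => [|y y1].
  by rewrite addr_ge0 // (le_trans _ (dual_normP _ y0)).
by rewrite (le_trans (ler_normD _ _))// lerD// dual_normP.
Qed.

Fact dual_normZ (a : K) (f : dual) : dual_norm (a *: f) = `|a| * dual_norm f.
Proof.
have nZ (b : K) (g : dual) : dual_norm (b *: g) <= `|b| * dual_norm g.
  have y0 : `|0 : Y| <= 1 by rewrite normr0.
  apply: supnorm_le => [|y y1].
    by rewrite mulr_ge0 // (le_trans _ (dual_normP _ y0)).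
  by rewrite [X in `|X|](_ : _ = b *: g y)// normrZ ler_wpM2l// dual_normP.
apply/eqP; rewrite eq_le nZ /=.
have [->|a0] := eqVneq a 0.
  rewrite normr0 mul0r.
  have y0 : `|0 : Y| <= 1 by rewrite normr0.
  by rewrite (le_trans _ (dual_normP _ y0)).
rewrite -ler_pdivlMl ?normr_gt0// -normfV.
by rewrite (le_trans _ (nZ _ _))// scalerA mulVf// scale1r.
Qed.

Fact dual_norm_eq0 (f : dual) : dual_norm f = 0 -> f = 0.
Proof.
move=> f0; apply/val_inj/funext => y /=.
have [->|y0] := eqVneq y 0; first by rewrite linear0.
have : `|f (`|y|^-1 *: y)| <= 0.
  rewrite -f0 dual_normP // normrZ normfV normr_id mulVf ?normr_eq0//.
rewrite normr_le0 linearZ/= scaler_eq0 invr_eq0 normr_eq0 (negPf y0) /=.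
by move/eqP.
Qed.

HB.instance Definition _ :=
  Lmodule_isNormed.Build K dual dual_normD dual_normZ dual_norm_eq0.

Lemma dual_normE (f : dual) : `|f| = dual_norm f. Proof. by []. Qed.

End dual.

(* sigma(Y^*, Y), as the topology induced by pointwise convergence on Y       *)
Definition weak_star (K : scalarField) (Y : normedModType K) : Type :=
  initial_topology (fun f : dual Y => (dual_fun f : {ptws Y -> K^o})).
HB.instance Definition _ (K : scalarField) (Y : normedModType K) :=
  Topological.on (weak_star Y).

(* sigma(Z, Z^* )                                                             *)
Definition weak (K : scalarField) (Z : normedModType K) : Type :=
  initial_topology (fun z : Z => ((fun phi : dual Z => phi z) :
    {ptws dual Z -> K^o})).
HB.instance Definition _ (K : scalarField) (Z : normedModType K) :=
  Topological.on (weak Z).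

Definition dual_ball (K : scalarField) (Y : normedModType K) : set (dual Y) :=
  [set f | `|f| <= 1].

(* w*-w PC of the dual unit ball; leaving the codomain unrestricted does not  *)
(* change continuity, as the ball carries the subspace topologies.            *)
Definition wstar_weak_PC (K : scalarField) (Y : normedModType K) (f : dual Y) :=
  dual_ball f /\
  {for f, continuous
    (id : subspace (@dual_ball K Y : set (weak_star Y)) -> weak (dual Y))}.

(* C(Omega, X) with the supremum norm; the compactness proof is a parameter   *)
(* of the type because the norm is finite only thanks to it.                  *)
Definition Cfun (K : scalarField) (Omega : topologicalType)
  (cptO : compact [set: Omega]) (X : normedModType K) : Type :=
  continuousType Omega X.

Section Cspace.
Context (K : scalarField) (Omega : topologicalType)
  (cptO : compact [set: Omega]) (X : normedModType K).

Local Notation Cspace := (Cfun cptO X).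

Definition cts_pred : {pred Omega -> X} :=
  mem [set f : Omega -> X | continuous f].

Section Sub.
Context (f : Omega -> X) (fP : f \in cts_pred).
Definition Cfun_Sub : Cspace := mkcts (set_mem fP).
End Sub.

Coercion Cfun_fun (f : Cspace) : Omega -> X :=
  (f : continuousType Omega X).

Lemma Cfun_rect (P : Cspace -> Type) :
  (forall f (Pf : f \in cts_pred), P (Cfun_Sub Pf)) -> forall u, P u.
Proof.
move=> Psub [f [[Pf]]].
by suff -> : Pf = (set_mem (@mem_set _ [set f | _] f Pf)) by exact: Psub.
Qed.

Lemma Cfun_valP f (Pf : f \in cts_pred) : Cfun_fun (Cfun_Sub Pf) = f.
Proof. by []. Qed.

HB.instance Definition _ := isSub.Build _ _ Cspace Cfun_rect Cfun_valP.
HB.instance Definition _ := [Choice of Cspace by <:].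

Lemma Cfun_continuous (f : Cspace) : continuous f.
Proof. exact: cts_fun. Qed.

Fact cts_submod_closed : submod_closed cts_pred.
Proof.
split; first by apply/mem_set; exact: cst_continuous.
move=> a f g /set_mem cf /set_mem cg; apply/mem_set => u.
exact: cvgD (cvgZl_tmp (k := a) (cf u)) (cg u).
Qed.
HB.instance Definition _ :=
  GRing.isSubmodClosed.Build K (Omega -> X) cts_pred cts_submod_closed.
HB.instance Definition _ := [SubChoice_isSubLmodule of Cspace by <:].

Definition sup_norm (f : Cspace) : K := supnorm [set: Omega] f.

Lemma sup_normP (f : Cspace) w : `|f w| <= sup_norm f.
Proof.
have : \forall M \near +oo_K, [set: Omega] `<=` [set t | `|f t| <= M].
  have /compact_near_coveringP := cptO; apply => x _.
  exists ([set t | `|f x - f t| <= 1], [set M : K | 1 + `|f x| <= M]).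
    split => /=; last first.
      by apply: nbhs_pinfty_ge; rewrite ger0_real// addr_ge0.
    have /cvgrPdist_le := @Cfun_continuous f x.
    exact.
  move=> [t M] /= [ft xM].
  rewrite -[f t](subrK (f x)) (le_trans (ler_normD _ _))// distrC.
  by rewrite (le_trans _ xM)// lerD2r.
move=> /pinfty_ex_gt0[M M0 fM].
by apply: (@supnormP _ _ _ _ _ M) => // t _; exact: fM.
Qed.

Fact sup_norm_ge0 (f : Cspace) : 0 <= sup_norm f.
Proof.
have [T0|/set0P[w _]] := eqVneq [set: Omega] set0.
  by rewrite /sup_norm /supnorm T0 image_set0 supremum0.
exact: le_trans (sup_normP f w).
Qed.

Fact sup_normD (f g : Cspace) : sup_norm (f + g) <= sup_norm f + sup_norm g.
Proof.
apply: supnorm_le => [|w _]; first by rewrite addr_ge0 ?sup_norm_ge0.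
by rewrite (le_trans (ler_normD _ _))// lerD// sup_normP.
Qed.

Fact sup_normZ (a : K) (f : Cspace) : sup_norm (a *: f) = `|a| * sup_norm f.
Proof.
have nZ (b : K) (g : Cspace) : sup_norm (b *: g) <= `|b| * sup_norm g.
  apply: supnorm_le => [|w _]; first by rewrite mulr_ge0 ?sup_norm_ge0.
  by rewrite [X in `|X|](_ : _ = b *: g w)// normrZ ler_wpM2l// sup_normP.
apply/eqP; rewrite eq_le nZ /=.
have [->|a0] := eqVneq a 0; first by rewrite normr0 mul0r sup_norm_ge0.
rewrite -ler_pdivlMl ?normr_gt0// -normfV.
by rewrite (le_trans _ (nZ _ _))// scalerA mulVf// scale1r.
Qed.

Fact sup_norm_eq0 (f : Cspace) : sup_norm f = 0 -> f = 0.
Proof.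
move=> f0; apply/val_inj/funext => w.
by apply/eqP; rewrite -normr_le0 -f0 sup_normP.
Qed.

HB.instance Definition _ :=
  Lmodule_isNormed.Build K Cspace sup_normD sup_normZ sup_norm_eq0.

Lemma sup_normE (f : Cspace) : `|f| = sup_norm f. Proof. by []. Qed.

Fact delta_tensor_subproof (w : Omega) (xs : dual X) :
  (fun f : Cspace => xs (f w)) \in @dual_pred K Cspace.
Proof.
apply/mem_set; have ev_lin : linear (fun f : Cspace => xs (f w)).
  by move=> a f g; rewrite -linearP.
split=> //.
pose l : {linear Cspace -> K^o} := HB.pack (fun f : Cspace => xs (f w))
  (GRing.isLinear.Build K Cspace K^o *:%R _ ev_lin).
apply: (@bounded_linear_continuous _ _ _ l).
apply/bounded_funP => r.
have [_ /(_ (@dual_continuous K X xs))/bounded_funP/(_ r)[M xsM]] :=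
  linear_bounded_continuous (xs : {linear X -> K^o}).
 exists M => f fr.
by apply: xsM; rewrite (le_trans (sup_normP f w)).
Qed.

Definition delta_tensor (w : Omega) (xs : dual X) : dual Cspace :=
  Dual (delta_tensor_subproof w xs).

End Cspace.

(* Main.v *)
Require Import Defs.
From HB Require Import structures.
From mathcomp Require Import all_boot all_order all_algebra.
From mathcomp Require Import all_classical all_reals all_analysis.
From mathcomp Require Import complex ring.
Import Order.TTheory GRing.Theory Num.Theory.
Import numFieldNormedType.Exports.
Set Implicit Arguments.
Unset Strict Implicit.
Unset Printing Implicit Defensive.
Local Open Scope classical_set_scope.
Local Open Scope ring_scope.

(** Write Y for C(Omega, X) and let Lambda be a point of weak*-to-weak
continuity (PC) of the dual ball.  The argument handles functionals
directly, without vector measures.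

Continuity is exploited through an interchange of limits
([PC_double_limit]).  If mu tends to Lambda weak* inside the ball and G is a
filter on the ball of Y, a limit of G along an ultrafilter is an element of
the bidual, and mu converges to Lambda at that element too.  So mu f and
Lambda f cannot stay apart along the iterated limit, f along G first and mu
second.

The functionals fed to it are finitely supported.  Given finitely many
functions, a partition of unity subordinate to their common oscillation
replaces Lambda f by Lambda applied to the sum of the h_w f(w), whose norm is
at most that of Lambda and whose centres w may be taken in any dense set D
([finite_support_approx]).  Hence Lambda f tends to 0 along every filter of
functions in the ball that eventually vanish at each given point of D
([PC_vanishing]).

Taking for D the complement of a non-isolated point w0, Lambda has
arbitrarily small mass near w0 ([PC_nonisolated]).  Taking D = Omega, and
using the previous fact to kill the functions at the non-isolated points at a
small cost, Lambda is concentrated, up to any e > 0, on finitely many isolated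
points ([PC_atomic]).

The norm of Lambda is 1 ([PC_norm1]): otherwise there is room to add to
Lambda a small multiple of (delta_w - delta_w0) (x) x* with w tending to a
non-isolated w0, which tends to 0 weak* but not weakly.  A nonzero x* exists
by the Hahn-Banach theorem, in the form: a minimal sublinear functional is
linear.

The restriction of a functional M to an isolated point p is its atom, a
functional on X, and M splits in the l^1 sense:
|M - c (delta_p (x) atom)| <= |M| - c |atom| for 0 <= c <= 1 ([peel_norm]).
With c = 1 this lets one vary the atom of Lambda inside a ball without leaving
the ball of the dual of Y, so the normalised atoms are PCs of the dual ball of
X ([PC_atom]).  With c = 1/2 it drives the construction of the series: starting
from Lambda, repeatedly peel off half of an atom of largest norm.  The peeled
norms alpha_n satisfy |M_n| + sum_(i < n) alpha_i = 1, so they tend to 0; since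
they dominate half of every atom of M_n, and M_n remains as concentrated as
Lambda, M_n tends to 0 in norm.  Peeling only half keeps all atoms alive, so
the series is infinite even if Lambda has finitely many atoms. *)

(** * The scalar field *)

Lemma gt0_complex (R : realType) (e : R[i]) :
  0 < e -> exists2 r : R, 0 < r & e = r%:C%C.
Proof.
by case: e => a b; rewrite ltcE /= => /andP[/eqP b0 a0]; exists a; rewrite // b0.
Qed.

Lemma normc_real (R : realType) (r : R) : `|r%:C%C| = `|r|%:C%C.
Proof. by rewrite normc_def /= expr0n /= addr0 sqrtr_sqr. Qed.

Lemma continuous_real_complex (R : realType) :
  continuous (fun r : R => r%:C%C : R[i]^o).
Proof.
move=> r; apply/cvgrPdist_lt => e /gt0_complex[d d0 ->].
near=> t; rewrite -rmorphB/= normc_real ltcR.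
near: t; exact: cvgr_dist_lt.
Unshelve. all: by end_near. Qed.

(** A copy of the reals inside K, through which real-valued Urysohn functions
become K-valued. *)
Lemma scalar_embedding (K : scalarField) :
  exists iota : scalar_base K -> K^o,
    [/\ iota 0 = 0, iota 1 = 1, continuous iota & {homo iota : x y / x <= y}].
Proof.
case: K => R L [] /=; first by exists id; split => // x; exact: cvg_id.
exists (fun r => r%:C%C); split=> //; first exact: continuous_real_complex.
by move=> x y; rewrite lecR.
Qed.

Lemma scalar_archimedean (K : scalarField) (e : K) :
  0 < e -> exists n : nat, n.+1%:R^-1 < e.
Proof.
have archi (R : realType) (r : R) : 0 < r -> exists n : nat, n.+1%:R^-1 < r.
  move=> r0; have [n _ /(_ n (leqnn n))] := near_infty_natSinv_lt (PosNum r0).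
  by exists n.
case: K e => R L [] /= e; first exact: archi.
move=> /gt0_complex[r /archi[n nr] ->]; exists n.
by rewrite -(rmorph_nat (real_complex R)) -fmorphV ltcR.
Qed.

(** For R[i], a bounded set lies in the image of a square under the continuous map
(a, b) |-> a + i b. *)
Lemma scalar_bounded_compact (K : scalarField) (M : K) :
  exists2 C : set K^o, compact C & [set z | `|z| <= M] `<=` C.
Proof.
case: K M => R L [] /= M.
  exists (`[- M, M]%classic : set R); first exact: segment_compact.
  by move=> z /=; rewrite ler_norml in_itv.
have f_cont : continuous (fun p : R * R => p.1%:C%C + 'i%C * p.2%:C%C : R[i]^o).
  have c1 : continuous (fun p : R * R => p.1%:C%C : R[i]^o).
    move=> p; apply: (@cvg_comp _ _ _ (fun p : R * R => p.1)
      (fun r : R => r%:C%C : R[i]^o) _ (nbhs p.1)); first exact: cvg_fst.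
    exact: continuous_real_complex.
  have c2 : continuous (fun p : R * R => p.2%:C%C : R[i]^o).
    move=> p; apply: (@cvg_comp _ _ _ (fun p : R * R => p.2)
      (fun r : R => r%:C%C : R[i]^o) _ (nbhs p.2)); first exact: cvg_snd.
    exact: continuous_real_complex.
  by move=> p; exact: cvgD (c1 p) (cvgZl_tmp (k := 'i%C : R[i]) (c2 p)).
pose N := complex.Re M.
eexists.
  apply: (@continuous_compact _ _ _ (`[-N, N]%classic `*` `[-N, N]%classic)).
    exact: continuous_subspaceT f_cont.
  apply: compact_setX; exact: segment_compact.
move=> z zM; exists (complex.Re z, complex.Im z); last by rewrite /= [RHS]complexE.
move: z zM => [a b]; rewrite /= normc_def => /=; rewrite /N; case: (M) => m n.
rewrite lecE /= => /andP[_ abm]; split; rewrite /= in_itv /= -ler_norml.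
  by rewrite (le_trans _ abm)// -sqrtr_sqr ler_wsqrtr// lerDl sqr_ge0.
by rewrite (le_trans _ abm)// -sqrtr_sqr ler_wsqrtr// lerDr sqr_ge0.
Qed.

(** * Bounded functionals and weak topologies *)

(** Both weak topologies are of this form: convergence is tested one evaluation at
a time. *)
Lemma cvg_initial_ptws (S : choiceType) (I : eqType) (V : topologicalType)
    (e : S -> I -> V) (H : set_system S) (s : S) : Filter H ->
  H --> (s : initial_topology (e : S -> {ptws I -> V})) <->
  (forall i, (e ^~ i) @ H --> e s i).
Proof.
move=> FH; split=> [Hs i|Hs].
  have es : (e : S -> {ptws I -> V}) @ H --> (e s : {ptws I -> V}).
    apply: cvg_trans (@initial_continuous _ _ (e : S -> {ptws I -> V}) s).
    exact: cvg_app.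
  apply: (@cvg_comp _ _ _ (e : S -> {ptws I -> V}) (proj i) _ _ _ es).
  exact: (@proj_continuous I (fun=> V) i (e s)).
move=> U [_ [[W oW <-] Ws WU]].
suff : ((e : S -> {ptws I -> V}) @ H) --> (e s : {ptws I -> V}).
  move=> /(_ W (open_nbhs_nbhs (conj oW Ws))) HW.
  by apply: filterS WU _.
apply/cvg_sup => i V' [_ [[W' oW' <-] W's W'V]].
apply: filterS W'V _.
exact: (Hs i _ (open_nbhs_nbhs (conj oW' W's))).
Qed.

Section dual_theory.
Context (K : scalarField) (Y : normedModType K).

Lemma dual_eq (f g : dual Y) : (forall y, f y = g y) -> f = g.
Proof. by move=> fg; apply/val_inj/funext. Qed.

Lemma ler_dual (f : dual Y) (y : Y) : `|f y| <= `|f| * `|y|.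
Proof.
have [->|y0] := eqVneq y 0; first by rewrite linear0 !normr0 mulr0.
have ny : 0 < `|y| by rewrite normr_gt0.
rewrite -ler_pdivrMr// mulrC.
have -> : `|y|^-1 * `|f y| = `|f (`|y|^-1 *: y)|.
  by rewrite linearZ /= normrZ normfV normr_id.
by apply: dual_normP; rewrite normrZ normfV normr_id mulVf ?gt_eqF.
Qed.

Lemma dual_norm_le (f : dual Y) (M : K) : 0 <= M ->
  (forall y, `|y| <= 1 -> `|f y| <= M) -> `|f| <= M.
Proof. by move=> M0 fM; apply: supnorm_le. Qed.

Lemma bounded_functional (g : Y -> K^o) (C : K) :
  0 <= C -> linear g -> (forall y, `|g y| <= C * `|y|) ->
  exists2 f : dual Y, dual_fun f = g & `|f| <= C.
Proof.
move=> C0 lg gC.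
pose l : {linear Y -> K^o} := HB.pack g
  (GRing.isLinear.Build K Y K^o *:%R _ lg).
have cg : continuous g.
  apply: (@bounded_linear_continuous _ _ _ l); apply/bounded_funP => r.
  exists (C * r) => y yr; rewrite (le_trans (gC y))//.
  by rewrite ler_wpM2l.
have Pg : g \in @dual_pred K Y by exact/mem_set.
exists (Dual Pg) => //.
apply: dual_norm_le => // y y1; rewrite (le_trans (gC y))//.
by rewrite -[leRHS]mulr1 ler_wpM2l.
Qed.

Lemma ler_dual1 (f : dual Y) (y : Y) : `|y| <= 1 -> `|f y| <= `|f|.
Proof. exact: dual_normP. Qed.

End dual_theory.

(** The filters H play the part of nets in the ball: the topologies of the
definition give way to convergence of evaluations. *)
Lemma wstar_weak_PC_cvg (K : scalarField) (Y : normedModType K) (f : dual Y) :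
  wstar_weak_PC f <->
  `|f| <= 1 /\ forall H : set_system (dual Y), Filter H ->
    H [set g | `|g| <= 1] ->
    (forall y, (fun g : dual Y => g y : K^o) @ H --> (f y : K^o)) ->
    forall phi : dual (dual Y), (fun g => phi g : K^o) @ H --> (phi f : K^o).
Proof.
have nbhs_ball : dual_ball f ->
  nbhs (f : subspace (@dual_ball K Y : set (weak_star Y))) =
  within (@dual_ball K Y) (nbhs (f : weak_star Y)).
  by move=> f1; rewrite (@nbhs_subspace_in (weak_star Y) (@dual_ball K Y)).
rewrite /wstar_weak_PC /prop_for /continuous_at /=.
split=> -[f1]; rewrite nbhs_ball// => PCf; split=> //.
  move=> H FH H1 Hf phi.
  suff : H --> (f : weak (dual Y)) by move/cvg_initial_ptws; apply.
  apply: cvg_trans PCf => U UP.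
  have : H --> (f : weak_star Y) by exact/cvg_initial_ptws.
  move=> /(_ _ UP); rewrite nbhs_simpl /=.
  by apply: filterS2 H1 => g g1; apply.
have FF : Filter (within (@dual_ball K Y) (nbhs (f : weak_star Y))).
  exact: within_filter.
suff : within (@dual_ball K Y) (nbhs (f : weak_star Y)) --> (f : weak (dual Y)).
  exact.
apply/cvg_initial_ptws => phi; apply: PCf.
  exact: withinT.
move=> y.
have /cvg_initial_ptws : nbhs (f : weak_star Y) --> (f : weak_star Y) by [].
move=> /(_ y); apply: cvg_trans; apply: cvg_app; exact: cvg_within.
Qed.

(** Compactness gives a cluster point of the image of U, and the image of an
ultrafilter converges to its cluster points. *)
Lemma bounded_ultra_cvg (K : scalarField) (T : Type) (U : set_system T)
    (g : T -> K^o) (M : K) :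
  UltraFilter U -> U [set t | `|g t| <= M] -> exists c : K^o, g @ U --> c.
Proof.
move=> UU UM; have [C /(_ (g @ U) _ _)cC MC] := scalar_bounded_compact M.
have [|c [Cc clc]] := cC.
  by apply: filterS UM => t; apply: MC.
exists c => V Vc; rewrite nbhs_simpl /=.
have [//|UV] := in_ultra_setVsetC (g @^-1` V) UU.
by have [z []] := clc (~` V) V UV Vc.
Qed.

(** Boundedness makes every evaluation converge along U; linearity and the norm
bound pass to the limit. *)
Lemma ultra_bidual (K : scalarField) (Y : normedModType K) (U : set_system Y) :
  UltraFilter U -> U [set y | `|y| <= 1] ->
  exists phi : dual (dual Y), forall mu : dual Y,
    (fun y => mu y : K^o) @ U --> (phi mu : K^o).
Proof.
move=> UU U1.
have Ule (mu : dual Y) : \forall y \near U, `|mu y| <= `|mu|.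
  by apply: filterS U1 => y; exact: ler_dual1.
have limP (mu : dual Y) : exists c : K^o, (fun y => mu y : K^o) @ U --> c.
  exact: bounded_ultra_cvg (Ule mu).
have [g gP] := choice limP.
have [//||mu|phi phiE _] := @bounded_functional K (dual Y) g 1.
- move=> a mu nu; apply: (cvg_unique _ (gP _)); first exact: norm_hausdorff.
  exact: cvgD (cvgZl_tmp (k := a) (gP mu)) (gP nu).
- rewrite mul1r real_leNgt ?normr_real//; apply/negP => mug.
  have [y []] := filter_ex (filterI (Ule mu) (cvgr_norm_gt _ (gP mu) _ mug)).
  by move=> /= /le_lt_trans /[apply]; rewrite ltxx.
by exists phi => mu; rewrite phiE.
Qed.

(** Refine G to an ultrafilter and let phi be its limit in the bidual.  Then phi g
tends to phi f along H, so some g in H is within e of f at phi, hence also at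
elements of Y that G brings close to phi. *)
Lemma PC_double_limit (K : scalarField) (Y : normedModType K) (f : dual Y)
    (G : set_system Y) (H : set_system (dual Y)) (e : K) :
  wstar_weak_PC f -> ProperFilter G -> ProperFilter H ->
  G [set y | `|y| <= 1] -> H [set g | `|g| <= 1] ->
  (forall y, (fun g : dual Y => g y : K^o) @ H --> (f y : K^o)) -> 0 < e ->
  ~ (\forall g \near H, \forall y \near G, e <= `|(g : dual Y) y - f y|).
Proof.
move=> /wstar_weak_PC_cvg[f1 PCf] PG PH G1 H1 Hf e0 Hge.
have [U [UU GU]] := ultraFilterLemma PG.
have [phi phiP] := ultra_bidual UU (GU _ G1).
have FH : Filter H by typeclasses eauto.
have cphi := PCf H FH H1 Hf phi.
have Hphi : \forall g \near H, `|phi f - phi g| < e.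
  by move/cvgrPdist_lt : cphi; apply.
have [g [gphi Gge]] := filter_ex (filterI Hphi Hge).
have Ug : \forall y \near U, `|(g - f) y| < e.
  by apply: (cvgr_norm_lt _ (phiP (g - f))); rewrite linearB /= distrC.
have [y [/= gy1 gy2]] := filter_ex (filterI Ug (GU _ Gge)).
by have := le_lt_trans gy2 gy1; rewrite ltxx.
Qed.

(** * Existence of nonzero functionals *)

Section sublinear.
Context (R : realType) (K : pzRingType) (iota : {rmorphism R -> K})
  (V : lmodType K).
Implicit Types (q : V -> R) (x y : V).

Definition sublinear q := (forall x y, q (x + y) <= q x + q y) /\
  (forall t x, 0 <= t -> q (iota t *: x) <= t * q x).

Lemma sublinear0 q : sublinear q -> q 0 = 0.
Proof.
move=> [qD qZ]; apply/eqP; rewrite eq_le; apply/andP; split.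
  by have := qZ 0 0 (lexx 0); rewrite scaler0 mul0r.
by have := qD 0 0; rewrite addr0 -lerBlDl subrr.
Qed.

Lemma sublinearZ q t x : sublinear q -> 0 <= t -> q (iota t *: x) = t * q x.
Proof.
move=> sq; rewrite le_eqVlt => /orP[/eqP <-|t0].
  by rewrite rmorph0 scale0r mul0r sublinear0.
apply/eqP; rewrite eq_le (proj2 sq t x (ltW t0)) /= -ler_pdivlMl//.
have := proj2 sq t^-1 (iota t *: x); rewrite scalerA -rmorphM mulVf ?gt_eqF//.
by rewrite rmorph1 scale1r; apply; rewrite invr_ge0 ltW.
Qed.

Lemma sublinearN q x : sublinear q -> - q (- x) <= q x.
Proof.
move=> sq; have := proj1 sq x (- x); rewrite subrr sublinear0// => qx.
by rewrite -subr_ge0 opprK.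
Qed.

(** The largest sublinear functional below q that is linear in the direction y: at
t *: y it takes the value t * q y for every real t. *)
Definition directional q y x : R :=
  inf [set q (x + iota t *: y) - t * q y | t in [set t | 0 <= t]].

Lemma directional_le q y x t : sublinear q -> 0 <= t ->
  directional q y x <= q (x + iota t *: y) - t * q y.
Proof.
move=> sq t0; apply: ge_inf; last by exists t.
exists (- q (- x)) => _ [s /= s0 <-].
rewrite lerBrDr -(sublinearZ _ sq s0) addrC lerBlDr.
by rewrite [X in q X <= _](_ : _ = x + iota s *: y - x) ?(proj1 sq)// addrC addKr.
Qed.

Lemma sublinear_directional q y : sublinear q -> sublinear (directional q y).
Proof.
move=> sq.
have set0P x : [set q (x + iota t *: y) - t * q y | t in [set t | 0 <= t]] !=set0.
  by exists (q (x + iota 0 *: y) - 0 * q y), 0 => /=.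
split=> [x1 x2|t x].
  rewrite -lerBlDr; apply: lb_le_inf => // _ [t1 /= t10 <-].
  rewrite lerBlDr -lerBlDl; apply: lb_le_inf => // _ [t2 /= t20 <-].
  rewrite lerBlDl; apply: le_trans (directional_le _ _ sq (addr_ge0 t10 t20)) _.
  rewrite rmorphD scalerDl addrACA mulrDl opprD [leRHS]addrACA lerD2r.
  exact: (proj1 sq).
rewrite le_eqVlt => /orP[/eqP <-|t0].
  rewrite rmorph0 scale0r mul0r (le_trans (directional_le _ _ sq (lexx 0)))//.
  by rewrite rmorph0 scale0r addr0 mul0r subr0 sublinear0.
rewrite -ler_pdivrMl//; apply: lb_le_inf => // _ [s /= s0 <-].
rewrite ler_pdivrMl//; have ts0 : 0 <= t * s by rewrite mulr_ge0// ltW.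
apply: le_trans (directional_le _ _ sq ts0) _.
by rewrite rmorphM -scalerA -scalerDr (sublinearZ _ sq (ltW t0)) mulrBr mulrA.
Qed.

(** Zorn's lemma: the pointwise infimum of a chain of sublinear functionals below
q0 is sublinear, and it is finite because each of them is at least
x |-> - q0 (- x). *)
Lemma minimal_sublinear q0 : sublinear q0 ->
  exists q, [/\ sublinear q, forall x, q x <= q0 x &
    forall p, sublinear p -> (forall x, p x <= q x) -> forall x, q x <= p x].
Proof.
move=> sq0.
pose T := {q | sublinear q /\ forall x, q x <= q0 x}.
pose le (p q : T) : bool := `[< forall x, sval q x <= sval p x >].
have t0 : T by exists q0.
have [||A Atot|q qmin] := @ZL_preorder T t0 le.
- by move=> p; apply/asboolP.
- move=> p q r /asboolP pq /asboolP qr; apply/asboolP => x.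
  exact: le_trans (qr x) (pq x).
- have [->|/set0P[a Aa]] := eqVneq A set0; first by exists t0.
  pose p x := inf [set sval s x | s in A].
  have Ap x : [set sval s x | s in A] !=set0 by exists (sval a x), a.
  have p_le s x : A s -> p x <= sval s x.
    move=> As; apply: ge_inf; last by exists s.
    exists (- q0 (- x)) => _ [r _ <-]; have [sr rq0] := svalP r.
    by rewrite (le_trans _ (sublinearN x sr))// lerN2.
  have sp : sublinear p.
    split=> [x y|t x].
      rewrite -lerBlDr; apply: lb_le_inf => // _ [r Ar <-].
      rewrite lerBlDr -lerBlDl; apply: lb_le_inf => // _ [s As <-].
      rewrite lerBlDl.
      have [/asboolP rs|/asboolP sr] := Atot _ _ Ar As.
        apply: le_trans (p_le s _ As) _; have [[+ _] _] := svalP s.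
        by move=> /(_ x y) /le_trans; apply; rewrite lerD2r.
      apply: le_trans (p_le r _ Ar) _; have [[+ _] _] := svalP r.
      by move=> /(_ x y) /le_trans; apply; rewrite lerD2l.
    rewrite le_eqVlt => /orP[/eqP <-|t0'].
      rewrite rmorph0 scale0r mul0r (le_trans (p_le a _ Aa))//.
      by rewrite sublinear0//; case: (svalP a).
    rewrite -ler_pdivrMl//; apply: lb_le_inf => // _ [s As <-].
    rewrite ler_pdivrMl//; apply: le_trans (p_le s _ As) _.
    by have [[_ +] _] := svalP s; apply; rewrite ltW.
  have pq0 x : p x <= q0 x.
    by apply: le_trans (p_le a x Aa) _; have [_] := svalP a; apply.
  exists (exist _ p (conj sp pq0)) => s As; apply/asboolP => x /=.
  exact: p_le.
exists (sval q); have [sq qq0] := svalP q; split=> // p sp pq x.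
have pq0 y : p y <= q0 y by exact: le_trans (pq y) (qq0 y).
have /asboolP := qmin (exist _ p (conj sp pq0)) (asboolT pq).
exact.
Qed.

(** A minimal sublinear u equals each of its directional versions, which forces
u x + u y <= u (x + y).  Minimising below the directional version of N at x0,
instead of N itself, pins the value at x0. *)
Lemma hahn_banach_sublinear N x0 : sublinear N ->
  exists u : V -> R, [/\ forall x y, u (x + y) = u x + u y,
    forall t x, u (iota t *: x) = t * u x,
    forall x, u x <= N x & N x0 <= u x0].
Proof.
move=> sN.
have [u [su uN umin]] := minimal_sublinear (sublinear_directional x0 sN).
have u0 := sublinear0 su.
have uD x y : u (x + y) = u x + u y.
  apply/eqP; rewrite eq_le (proj1 su)/=.
  have := umin _ (sublinear_directional y su).
  have -> : (forall z, directional u y z <= u z) = True.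
    apply/propext; split=> // _ z.
    apply: le_trans (directional_le _ _ su (lexx 0)) _.
    by rewrite rmorph0 scale0r addr0 mul0r subr0.
  move=> /(_ I x) /le_trans /(_ (directional_le _ _ su ler01)).
  by rewrite rmorph1 scale1r mul1r lerBrDr.
have uN' x : u (- x) = - u x.
  by apply/eqP; rewrite -addr_eq0 -uD addNr u0.
exists u; split=> //.
- move=> t x; have [t0|t0] := leP 0 t; first exact: sublinearZ.
  rewrite -[t]opprK rmorphN scaleNr uN' sublinearZ ?mulNr// oppr_ge0; exact: ltW.
- move=> x; apply: le_trans (uN x) _.
  apply: le_trans (directional_le _ _ sN (lexx 0)) _.
  by rewrite rmorph0 scale0r addr0 mul0r subr0.
- rewrite -lerN2 -uN' (le_trans (uN _))//.
  apply: le_trans (directional_le _ _ sN ler01) _.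
  by rewrite rmorph1 scale1r addNr mul1r sublinear0// sub0r.
Qed.

End sublinear.

(** Over R[i], a real functional u dominated by the norm is the real part of
x |-> u x - i u (i x). *)
Lemma nonzero_functional (K : scalarField) (X : normedModType K) (x0 : X) :
  x0 != 0 -> exists xs : dual X, xs x0 != 0.
Proof.
case: K X x0 => R L RL X x0; set K := ScalarField RL in X x0 *.
suff [f [lf [C C0 fC] fx0]] : exists f : X -> K^o,
    [/\ linear f, exists2 C : K, 0 <= C & forall x, `|f x| <= C * `|x| &
    (x0 != 0 -> f x0 != 0)].
  move=> /fx0 fx; have [xs xsE _] := bounded_functional C0 lf fC.
  by exists xs; rewrite xsE.
rewrite /K {K} in X x0 *; case: RL X x0 => X x0.
- have sN : sublinear (idfun : {rmorphism R -> R}) (fun x : X => `|x|).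
    split=> [x y|t x t0]; first exact: ler_normD.
    by rewrite normrZ ger0_norm.
  have [u [uD uZ uN ux0]] := hahn_banach_sublinear x0 sN.
  exists u; split.
  + by move=> a x y; rewrite uD uZ.
  + exists 1 => // x; rewrite mul1r ler_norml uN andbT.
    have := uN ((-1) *: x); rewrite (uZ (-1)) scaleN1r normrN mulN1r lerNl.
    exact.
  + by move=> x0_neq0; rewrite gt_eqF// (lt_le_trans _ ux0)// normr_gt0.
pose N (x : X) : R := complex.Re `|x|.
have NE x : `|x| = (N x)%:C%C.
  by have := normr_ge0 x; rewrite /N lecE /=; case: `|x| => a b /= /andP[/eqP-> _].
have sN : sublinear (real_complex R) N.
  split=> [x y|t x t0].
    by have := ler_normD x y; rewrite !NE -rmorphD lecR.
  have := normrZ (t%:C%C) x; rewrite !NE normc_real ger0_norm// -rmorphM => /complexI ->.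
  by [].
have [u [uD uZ uN ux0]] := hahn_banach_sublinear x0 sN.
have u_le x : `|u x| <= N x.
  rewrite ler_norml uN andbT; have := uN ((real_complex R (-1)) *: x).
  rewrite uZ rmorphN rmorph1 scaleN1r mulN1r lerNl.
  by have -> : N (- x) = N x by rewrite /N normrN.
have Ni x : N ('i%C *: x) = N x.
  by rewrite /N normrZ normc_def /= expr0n expr1n add0r sqrtr1 mul1r.
pose f (x : X) : R[i] := (u x +i* - u ('i%C *: x))%C.
have uZc (a b : R) x : u ((a +i* b)%C *: x) = a * u x + b * u ('i%C *: x).
  rewrite -!uZ -uD scalerA -scalerDl; congr (u (_ *: _)).
  by rewrite [LHS]complexE /= mulrC.
exists f; split.
- move=> [a b] x y; apply/eqP; rewrite eq_complex /= scalerDr !uD uZc.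
  have -> : 'i%C *: ((a +i* b)%C *: x) = ((- b) +i* a)%C *: x.
    rewrite scalerA; congr (_ *: _); apply/eqP; rewrite eq_complex /=.
    by rewrite !mul0r !mul1r sub0r add0r !eqxx.
  rewrite (uZc (- b) a x); apply/andP; split; apply/eqP; rewrite /=; ring.
- exists 2 => // x.
  rewrite [f x]complexE (le_trans (ler_normD _ _))// mulr2n mulrDl mul1r lerD//.
    by rewrite normc_real NE lecR u_le.
  rewrite normrM normc_real normrN normc_def /= expr0n expr1n add0r sqrtr1 mul1r.
  by rewrite NE lecR -Ni u_le.
- move=> x0_neq0; rewrite eq_complex negb_and /= gt_eqF//.
  rewrite (lt_le_trans _ ux0)//.
  have : 0 < `|x0| by rewrite normr_gt0.
  by rewrite NE ltcR.
Qed.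

(** * Approximation by finitely supported functionals *)

Section Cspace_theory.
Context (K : scalarField) (Omega : topologicalType)
  (cptO : compact [set: Omega]) (X : normedModType K).
Local Notation Y := (Cfun cptO X).

Lemma Cfun_eq (f g : Y) : (forall w, f w = g w) -> f = g.
Proof. by move=> fg; apply/val_inj/funext. Qed.

Lemma Cfun_norm_le (f : Y) (M : K) :
  0 <= M -> (forall w, `|f w| <= M) -> `|f| <= M.
Proof. by move=> M0 fM; apply: supnorm_le. Qed.

Lemma Cfun_ler (f : Y) (w : Omega) : `|f w| <= `|f|.
Proof. exact: sup_normP. Qed.

Definition mkCfun (g : Omega -> X) (cg : continuous g) : Y :=
  Cfun_Sub cptO (mem_set cg).

Lemma continuous_bigsum (V : normedModType K) (I : Type) (r : seq I)
    (F : I -> Omega -> V) :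
  (forall i, continuous (F i)) -> continuous (fun t => \sum_(i <- r) F i t).
Proof.
move=> cF; apply: continuous_big => [|i _]; [exact: add_continuous|exact: cF].
Qed.

(** Finite subsets of D, directed by inclusion, form the filter to which the
near-covering form of compactness is applied. *)
Lemma compact_finite_cover (D : set Omega) (A : Omega -> set Omega) :
  (forall t : Omega, exists2 w, D w & nbhs t (A w)) ->
  exists2 c : seq Omega, (forall w, w \in c -> D w) &
    forall t, exists2 w, w \in c & A w t.
Proof.
move=> DA.
pose inD (c : seq Omega) := forall w, w \in c -> D w.
pose F := filter_from inD
  (fun c0 => [set c | inD c /\ forall w, w \in c0 -> w \in c]).
have FF : ProperFilter F.
  apply: filter_from_proper; last by move=> c cD; exists c.
  apply: filter_from_filter; first by exists [::].
  move=> c1 c2 c1D c2D; exists (c1 ++ c2).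
    by move=> w; rewrite mem_cat => /orP[/c1D|/c2D].
  by move=> c [cD cc]; split; split => // w wc; apply: cc; rewrite mem_cat wc ?orbT.
suff : F [set c | inD c /\ forall t, exists2 w, w \in c & A w t].
  by move=> /filter_ex[c [cD cA]]; exists c.
have Fcov : \forall c \near F, [set: Omega] `<=` [set t | exists2 w, w \in c & A w t].
  move/compact_near_coveringP : cptO; apply => t _.
  have [w Dw Aw] := DA t.
  exists (A w, [set c : seq Omega | w \in c]); last first.
    by move=> [x c] /= [Awx wc]; exists w.
  split => //=; exists [:: w]; first by move=> v; rewrite inE => /eqP ->.
  by move=> c [_]; apply; rewrite inE.
have FD : F inD by exists [::] => // c [].
by apply: filterS2 FD Fcov => c cD cA; split => // t; exact: cA.
Qed.

(** The functions max(0, d - N w) normalised by their sum; twice the maximum is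
|u| + u, which avoids comparing elements of K.  The pseudometric N itself
supplies the bumps. *)
Lemma metric_partition_of_unity (N : Omega -> Omega -> K^o) (D : set Omega) (d : K) :
  (forall w, continuous (N w)) -> (forall w t, 0 <= N w t) ->
  (forall w t, N w t = N t w) -> (forall w, N w w = 0) ->
  0 < d -> dense D ->
  exists (c : seq Omega) (h : Omega -> Omega -> K^o),
    [/\ forall w, w \in c -> D w,
        forall w, continuous (h w),
        forall w t, 0 <= h w t,
        forall t, \sum_(w <- c) h w t = 1 &
        forall w t, h w t != 0 -> N w t < d].
Proof.
move=> cN N0 NC Nw d0 denseD.
pose u w t : K^o := d - N w t.
pose g w t : K^o := `|u w t| + u w t.
have cu w : continuous (u w).
  by move=> t; apply: cvgB; [exact: cvg_cst|exact: cN].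
have cg w : continuous (g w).
  by move=> t; apply: cvgD (cu w t); exact: cvg_norm (cu w t).
have g_gt0 w t : N w t < d -> 0 < g w t.
  by move=> Nd; rewrite /g addrC ltr_wpDr// subr_gt0.
have g_eq0 w t : ~~ (N w t < d) -> g w t = 0.
  rewrite -real_leNgt ?(gtr0_real d0) ?ger0_real// => dN.
  by rewrite /g ler0_norm ?subr_le0// addNr.
have g0 w t : 0 <= g w t.
  by have [/g_gt0/ltW//|/g_eq0->] := boolP (N w t < d).
have openN w : open [set t | N w t < d].
  rewrite openE => t /= Nt.
  have : \forall x \near t, `|N w x| < d.
    by apply: (cvgr_norm_lt _ (cN w t)); rewrite ger0_norm.
  by apply: filterS => x; rewrite ger0_norm.
have [c cD ccov] : exists2 c : seq Omega, (forall w, w \in c -> D w) &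
    forall t, exists2 w, w \in c & N w t < d.
  apply: compact_finite_cover => t.
  have [|w [/= tw Dw]] := denseD _ _ (openN t); first by exists t; rewrite /= Nw.
  by exists w => //; apply: open_nbhs_nbhs; split; [exact: openN|rewrite /= NC].
pose G t : K^o := \sum_(w <- c) g w t.
have G_gt0 t : 0 < G t.
  have [w wc /g_gt0 gwt] := ccov t; rewrite /G.
  by rewrite (big_rem w)//= ltr_pwDl// sumr_ge0.
exists c, (fun w t => (G t)^-1 *: g w t); split=> //.
- move=> w t; apply: cvgZ; last exact: cg.
  apply: cvgV; first by rewrite gt_eqF.
  exact: (continuous_bigsum cg).
- by move=> w t; rewrite mulr_ge0// invr_ge0 ltW.
- by move=> t; rewrite -scaler_sumr [LHS]mulVf// gt_eqF.
- move=> w t; apply: contraNT => /g_eq0 ->.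
  by rewrite scaler0.
Qed.

(** Transpose of the contraction f |-> \sum_w h_w f(w), where h is a partition of
unity subordinate to the pseudometric \sum_(f <- s) |f t - f w|. *)
Lemma finite_support_approx (L : dual Y) (D : set Omega) (s : seq Y) (d : K) :
  0 < d -> dense D ->
  exists mu : dual Y, [/\ `|mu| <= `|L|,
    exists2 c : seq Omega, (forall w, w \in c -> D w) &
      forall f : Y, (forall w, w \in c -> f w = 0) -> mu f = 0 &
    forall f, f \in s -> `|mu f - L f| <= `|L| * d].
Proof.
move=> d0 denseD.
pose N (w t : Omega) : K^o := \sum_(f <- s) `|f t - f w|.
have cN w : continuous (N w).
  apply: continuous_bigsum => f t; apply: cvg_norm; apply: cvgB.
    exact: Cfun_continuous.
  exact: cvg_cst.
have [|||//|//|c [h [cD ch h0 h1 hN]]] := @metric_partition_of_unity N D d cN.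
- by move=> w t; apply: sumr_ge0.
- by move=> w t; apply: eq_bigr => f _; rewrite distrC.
- by move=> w; rewrite /N big1// => f _; rewrite subrr normr0.
pose T (f : Y) t : X := \sum_(w <- c) h w t *: f w.
have cT f : continuous (T f).
  by apply: continuous_bigsum => w t; apply: cvgZ; [exact: ch|exact: cvg_cst].
have T_le (F : Omega -> X) t (M : K) : 0 <= M ->
    (forall w, h w t != 0 -> `|F w| <= M) ->
    `|\sum_(w <- c) h w t *: F w| <= M.
  move=> M0 FM; rewrite (le_trans (ler_norm_sum _ _ _))//.
  rewrite -[leRHS]mul1r -(h1 t) mulr_suml; apply: ler_sum => w _.
  rewrite normrZ ger0_norm//.
  have [->|/FM] := eqVneq (h w t) 0; first by rewrite !mul0r.
  exact: ler_wpM2l.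
have [|||mu muE mu1] := @bounded_functional K Y (fun f => L (mkCfun (cT f))) `|L|.
- by [].
- move=> a f g; rewrite -linearP; congr (L _); apply: Cfun_eq => t.
  rewrite /= [RHS](_ : _ = a *: T f t + T g t)// /T scaler_sumr -big_split /=.
  by apply: eq_bigr => w _; rewrite scalerDr !scalerA mulrC.
- move=> f; rewrite (le_trans (ler_dual _ _))// ler_wpM2l//.
  apply: Cfun_norm_le => // t; apply: T_le => // w _; exact: Cfun_ler.
exists mu; split=> // [|f fs].
  exists c => // f f0; rewrite muE; rewrite [mkCfun _](_ : _ = 0) ?linear0//.
  apply: Cfun_eq => t; rewrite [LHS](_ : _ = T f t)// /T big_seq big1// => w.
  by move=> /f0 ->; rewrite scaler0.
rewrite muE -linearB (le_trans (ler_dual _ _))// ler_wpM2l//.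
apply: Cfun_norm_le => [|t]; first exact: ltW.
rewrite [X in `|X|](_ : _ = \sum_(w <- c) h w t *: (f w - f t)).
  apply: T_le => [|w /hN]; first exact: ltW.
  move=> /ltW; apply: le_trans; rewrite /N (big_rem f)//= distrC lerDl.
  exact: sumr_ge0.
rewrite [LHS](_ : _ = T f t - f t)// -[f t in LHS]scale1r -(h1 t) scaler_suml -sumrB.
by apply: eq_bigr => w _; rewrite scalerBr.
Qed.

End Cspace_theory.

(** * Mass of a point of continuity *)

Lemma near_seq (I : eqType) (T : Type) (G : set_system T) (P : I -> T -> Prop)
    (c : seq I) : Filter G ->
  (forall i, i \in c -> \forall t \near G, P i t) ->
  \forall t \near G, forall i, i \in c -> P i t.
Proof.
move=> FG; elim: c => [|i c IH] cP; first exact: nearW.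
have Pc : \forall t \near G, forall j, j \in c -> P j t.
  by apply: IH => j jc; apply: cP; rewrite inE jc orbT.
apply: filterS2 (cP i (mem_head _ _)) Pc => t Pit Pct j.
by rewrite inE => /orP[/eqP ->|/Pct].
Qed.

Section PC_theory.
Context (K : scalarField) (Omega : topologicalType)
  (cptO : compact [set: Omega]) (X : normedModType K).
Local Notation Y := (Cfun cptO X).

(** Functionals supported by finitely many points of D tend to L weak* and vanish
eventually along G; the interchange of limits makes L itself tend to 0. *)
Lemma PC_vanishing (L : dual Y) (D : set Omega) (G : set_system Y) (e : K) :
  wstar_weak_PC L -> dense D -> ProperFilter G ->
  G [set f | `|f| <= 1] ->
  (forall w, D w -> \forall f \near G, (f : Y) w = 0) ->
  0 < e -> ~ \forall f \near G, e <= `|L f|.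
Proof.
move=> PCL denseD PG G1 GD e0 GL.
have L1 : `|L| <= 1 by case: PCL.
(* Basic weak* neighbourhoods of L, cut down to the ball and to the
   functionals supported by finitely many points of D. *)
pose B (p : seq Y * nat) := [set mu : dual Y | [/\ `|mu| <= 1,
   exists2 c : seq Omega, (forall w, w \in c -> D w) &
      forall f : Y, (forall w, w \in c -> f w = 0) -> mu f = 0 &
    forall f, f \in p.1 -> `|mu f - L f| <= p.2.+1%:R^-1]].
have PH : ProperFilter (filter_from setT B).
  apply: filter_from_proper.
    apply: filter_fromT_filter; first by exists ([::], 0%N).
    move=> [s n] [s' n']; exists (s ++ s', maxn n n') => mu /= [mu1 mufin mus].
    split; split => //= f fs;
      (apply: le_trans (mus f _) _; first by rewrite mem_cat fs ?orbT);
      by rewrite lef_pV2 ?posrE// ler_nat ltnS ?leq_maxl ?leq_maxr.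
  move=> [s n] _; have n0 : 0 < (n.+1%:R^-1 : K) by rewrite invr_gt0.
  have [mu [muL mufin mus]] := finite_support_approx L s n0 denseD.
  exists mu; split=> //= [|f fs]; first exact: le_trans muL L1.
  by apply: le_trans (mus f fs) _; rewrite -[leRHS]mul1r ler_wpM2r// ltW.
apply: (PC_double_limit PCL PG PH G1 _ _ e0).
- by exists ([::], 0%N) => // mu [].
- move=> f; apply/cvgrPdist_lt => d d0.
  have [n nd] := scalar_archimedean d0.
  exists ([:: f], n) => // mu /= [_ _ /(_ f)]; rewrite mem_head => /(_ isT).
  by rewrite distrC => /le_lt_trans; apply.
- exists ([::], 0%N) => // mu [_ [c cD cmu] _].
  have Gc : \forall f \near G, forall w, w \in c -> (f : Y) w = 0.
    by apply: near_seq => w /cD; exact: GD.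
  by apply: filterS2 GL Gc => f Lf /cmu ->; rewrite sub0r normrN.
Qed.

Lemma dense_setC1 (w : Omega) :
  ~ isolated [set: Omega] w -> dense (~` [set w]).
Proof.
move=> niw O [t Ot] oO; apply: contrapT => Ow; apply: niw; split.
  by rewrite inE.
have Ow' : O `<=` [set w].
  by move=> s Os; apply: contrapT => sw; apply: Ow; exists s.
exists O; first by apply: open_nbhs_nbhs; split => //; rewrite -(Ow' t Ot).
by rewrite setIT; apply/seteqP; split => // s ->; rewrite -(Ow' t Ot).
Qed.

Hypothesis hausO : hausdorff_space Omega.

(** Otherwise unit functions supported in smaller and smaller neighbourhoods of w0
keep |L f| >= e, although they eventually vanish at each point other than
w0, and those points are dense. *)
Lemma PC_nonisolated (L : dual Y) (w0 : Omega) (e : K) :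
  wstar_weak_PC L -> ~ isolated [set: Omega] w0 -> 0 < e ->
  exists2 U, nbhs w0 U & forall f : Y, `|f| <= 1 ->
    (forall w, ~ U w -> f w = 0) -> `|L f| < e.
Proof.
move=> PCL niw e0; apply: contrapT => noU.
pose B (U : set Omega) := [set f : Y |
  [/\ `|f| <= 1, forall w, ~ U w -> f w = 0 & e <= `|L f|]].
have PG : ProperFilter (filter_from (nbhs w0) B).
  apply: filter_from_proper.
    apply: filter_from_filter; first by exists setT; exact: filterT.
    move=> U V nU nV; exists (U `&` V); first exact: filterI.
    by move=> f [f1 fUV Lf]; split; split => // w nUw; apply: fUV => -[].
  move=> U nU; apply: contrapT => BU; apply: noU; exists U => // f f1 fU.
  rewrite real_ltNge ?normr_real ?gtr0_real//; apply/negP => Lf.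
  by apply: BU; exists f.
apply: (PC_vanishing PCL (dense_setC1 niw) PG _ _ e0).
- by exists setT; [exact: filterT|move=> f []].
- move=> w /= ww0; exists (~` [set w]); last by move=> f [_ fw _]; apply: fw; apply.
  apply: open_nbhs_nbhs; split; last by move=> /esym.
  exact/closed_openC/accessible_closed_set1/hausdorff_accessible.
- by exists setT; [exact: filterT|move=> f []].
Qed.

Lemma bump (w : Omega) (U : set Omega) : nbhs w U ->
  exists b : Omega -> K^o, [/\ continuous b, forall t, 0 <= b t <= 1,
    b w = 1 & forall t, ~ U t -> b t = 0].
Proof.
move=> nU.
have [iota [i0 i1 ci imono]] := scalar_embedding K.
have nO := compact_normal hausO cptO.
have clw : closed [set w] by exact/accessible_closed_set1/hausdorff_accessible.
have sep : uniform_separator (~` U°) [set w].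
  apply: (proj1 (@normal_separatorP (scalar_base K) Omega) nO) => //.
    exact/open_closedC/open_interior.
  by apply/disjoints_subset => t nUt tw; apply: nUt; rewrite tw.
have [f [cf f01 fU fw]] := proj1 (@uniform_separatorP _ (scalar_base K) _ _) sep.
exists (iota \o f); split.
- by move=> t; apply: continuous_comp; [exact: cf|exact: ci].
- move=> t; have : (f t) \in `[0, 1] by apply: f01; exists t.
  by rewrite in_itv /= => /andP[/imono + /imono]; rewrite i0 i1 => -> ->.
- by rewrite /= (fw (f w)) //; exists w.
- move=> t nUt; rewrite /= (fU (f t)) //; exists t => // /interior_subset.
  exact: nUt.
Qed.

End PC_theory.

(** * Atoms at isolated points *)

Section atoms.
Context (K : scalarField) (Omega : topologicalType)
  (cptO : compact [set: Omega]) (X : normedModType K)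
  (hausO : hausdorff_space Omega).
Local Notation Y := (Cfun cptO X).

(** A boolean subtype, so as to inherit decidable equality from Omega. *)
Definition iso_point := {w : Omega | `[< isolated [set: Omega] w >]}.

Lemma isoP (p : iso_point) : isolated [set: Omega] (val p).
Proof. exact/asboolP/(valP p). Qed.

Lemma continuous_spike (p : iso_point) (x : X) :
  continuous (fun t => if t == val p then x else 0).
Proof.
have [_ [V nV]] := isoP p; rewrite setIT => Vp; rewrite Vp in nV.
move=> t; have [->|tp] := eqVneq t (val p).
  apply: (near_cst_continuous x); apply: filterS nV => s ->; by rewrite eqxx.
apply: (near_cst_continuous (0 : X)).
have : nbhs t (~` [set val p]).
  apply: open_nbhs_nbhs; split; last exact/eqP.
  exact/closed_openC/accessible_closed_set1/hausdorff_accessible.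
by apply: filterS => s /eqP/negPf ->.
Qed.

Definition spike (p : iso_point) (x : X) : Y := mkCfun cptO (@continuous_spike p x).

Lemma spikeE p x t : spike p x t = if t == val p then x else 0.
Proof. by []. Qed.

Lemma spike_linear p : linear (spike p).
Proof.
move=> a x y; apply: Cfun_eq => t.
rewrite [RHS](_ : _ = a *: spike p x t + spike p y t)// !spikeE.
by case: ifP => // _; rewrite scaler0 addr0.
Qed.

Lemma spike_norm p x : `|spike p x| <= `|x|.
Proof. by apply: Cfun_norm_le => // t; rewrite spikeE; case: ifP; rewrite ?normr0. Qed.

Lemma atom_exists (M : dual Y) (p : iso_point) :
  exists2 m : dual X, dual_fun m = (fun x => M (spike p x)) & `|m| <= `|M|.
Proof.
apply: bounded_functional => // [a x y|x]; first by rewrite spike_linear linearP.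
by rewrite (le_trans (ler_dual _ _))// ler_wpM2l// spike_norm.
Qed.

(** The restriction of M to the point p, as a functional on X. *)
Definition atom M p : dual X := projT1 (cid2 (atom_exists M p)).

Lemma atomE M p x : atom M p x = M (spike p x).
Proof. by rewrite /atom; case: cid2 => m /= ->. Qed.

Lemma delta_tensorE (w : Omega) (xs : dual X) (f : Y) :
  delta_tensor cptO w xs f = xs (f w).
Proof. by []. Qed.

Lemma atomB c (M N : dual Y) p : atom (M - c *: N) p = atom M p - c *: atom N p.
Proof.
apply: dual_eq => x; rewrite atomE.
by rewrite [RHS](_ : _ = atom M p x - c *: atom N p x)// !atomE.
Qed.

Lemma atom_delta p q (xs : dual X) :
  atom (delta_tensor cptO (val p) xs) q = if p == q then xs else 0.
Proof.
apply: dual_eq => x; rewrite atomE delta_tensorE spikeE val_eqE.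
by case: ifP => // _; rewrite linear0.
Qed.

Lemma scalar_sign (z : K^o) : exists2 s : K, `|s| = 1 & s * z = `|z|.
Proof.
have [->|z0] := eqVneq z 0.
  by exists 1; rewrite ?normr1// normr0 mulr0.
exists (`|z| / z); first by rewrite normrM normfV normr_id mulfV ?normr_eq0.
by rewrite mulfVK.
Qed.

(** f off p and a vector x at p can be rotated by scalars of modulus 1
independently, and glued into one function of norm at most 1. *)
Lemma atom_norm_add (M : dual Y) p (f : Y) : `|f| <= 1 ->
  `|M (f - spike p (f (val p)))| + `|atom M p| <= `|M|.
Proof.
move=> f1; set g : Y := f - _; rewrite addrC -lerBrDr.
have key x : `|x| <= 1 -> `|atom M p x| <= `|M| - `|M g|.
  move=> x1; rewrite lerBrDr atomE.
  have [s s1 sM] := scalar_sign (M g).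
  have [t t1 tM] := scalar_sign (M (spike p x)).
  have h1 : `|t *: spike p x + s *: g| <= 1.
    apply: Cfun_norm_le => // w.
    rewrite [X in `|X|](_ : _ = t *: spike p x w + s *: (f w - spike p (f (val p)) w))//.
    rewrite !spikeE; case: eqP => [->|_].
      by rewrite subrr scaler0 addr0 normrZ t1 mul1r.
    by rewrite subr0 scaler0 add0r normrZ s1 mul1r (le_trans (Cfun_ler _ _)).
  apply: le_trans (ler_dual1 M h1).
  have -> : M (t *: spike p x + s *: g) = `|M (spike p x)| + `|M g|.
    by rewrite linearP linearZ /= -sM -tM.
  by rewrite [leRHS]ger0_norm ?addr_ge0.
apply: dual_norm_le => //.
have := key 0; rewrite normr0 => /(_ ler01); exact: le_trans.
Qed.

Lemma peel_norm (M : dual Y) p (c : K) : 0 <= c <= 1 ->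
  `|M - c *: delta_tensor cptO (val p) (atom M p)| <= `|M| - c * `|atom M p|.
Proof.
move=> /andP[c0 c1].
have aM : `|atom M p| <= `|M|.
  apply: dual_norm_le => // x x1; rewrite atomE ler_dual1//.
  exact: le_trans (spike_norm p x) x1.
apply: dual_norm_le => [|f f1].
  by rewrite subr_ge0 (le_trans _ aM)// -[leRHS]mul1r ler_wpM2r.
rewrite [X in `|X|](_ : _ = M (f - spike p (f (val p)))
    + (1 - c) *: atom M p (f (val p))).
  rewrite (le_trans (ler_normD _ _))// normrZ ger0_norm ?subr_ge0//.
  have := atom_norm_add M p f1; rewrite -lerBrDr => /(lerD) H.
  apply: le_trans (H _ ((1 - c) * `|atom M p|) _) _.
    rewrite ler_wpM2l ?subr_ge0// ler_dual1//.
    exact: le_trans (Cfun_ler _ _) f1.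
  by rewrite mulrBl mul1r addrA subrK.
rewrite [LHS](_ : _ = M f - c *: atom M p (f (val p)))// linearB /= atomE.
by rewrite scalerBl scale1r addrA subrK.
Qed.

End atoms.

(** * Atomicity and continuity at the atoms *)

Section PC_structure.
Context (K : scalarField) (Omega : topologicalType)
  (cptO : compact [set: Omega]) (X : normedModType K)
  (hausO : hausdorff_space Omega).
Local Notation Y := (Cfun cptO X).

(** Multiply f by 1 - b for a bump b supported near each point in turn; by
[PC_nonisolated] the part b f that is thrown away costs as little as wished. *)
Lemma PC_cutoff (L : dual Y) (c : seq Omega) : wstar_weak_PC L ->
  (forall w, w \in c -> ~ isolated [set: Omega] w) ->
  forall (f : Y) (e : K), `|f| <= 1 -> 0 < e -> exists g : Y,
    [/\ `|g| <= 1, forall w, w \in c -> g w = 0,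
        forall w, f w = 0 -> g w = 0 & `|L f| <= `|L g| + e].
Proof.
move=> PCL; elim: c => [|w c IH] ic f e f1 e0.
  by exists f; split=> //; rewrite lerDl ltW.
have e2 : 0 < e / 2 by rewrite divr_gt0.
have [|g [g1 gc fg Lg]] := IH _ f (e / 2) f1 e2.
  by move=> v vc; apply: ic; rewrite inE vc orbT.
have [U nU LU] := PC_nonisolated hausO PCL (ic w (mem_head _ _)) e2.
have [b [cb b01 bw bU]] := bump K cptO hausO nU.
have cbg : continuous (fun t => b t *: g t).
  by move=> t; apply: cvgZ; [exact: cb|exact: Cfun_continuous].
pose bg : Y := mkCfun cptO cbg.
have bgE t : bg t = b t *: g t by [].
have gbgE t : (g - bg) t = (1 - b t) *: g t by rewrite scalerBl scale1r.
have scale_le t (a : K) : 0 <= a <= 1 -> `|a *: g t| <= 1.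
  move=> /andP[a0 a1]; rewrite normrZ ger0_norm// mulr_ile1//.
  exact: le_trans (Cfun_ler _ _) g1.
exists (g - bg); split.
- apply: Cfun_norm_le => // t; rewrite gbgE scale_le//.
  by have /andP[b0 b1] := b01 t; rewrite subr_ge0 b1 gerBl.
- move=> v; rewrite inE gbgE => /orP[/eqP ->|/gc ->]; last by rewrite scaler0.
  by rewrite bw subrr scale0r.
- by move=> v /fg; rewrite gbgE => ->; rewrite scaler0.
- apply: le_trans Lg _; rewrite [X in _ <= _ + X]splitr addrA lerD2r.
  have -> : L g = L (g - bg) + L bg by rewrite linearB /= subrK.
  rewrite (le_trans (ler_normD _ _))// lerD2l; apply/ltW/LU.
    by apply: Cfun_norm_le => // t; exact: scale_le.
  by move=> t /bU bt; rewrite bgE bt scale0r.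
Qed.

(** Were it false, every finite set of points c would admit f in the ball with
f = 0 at the isolated points of c and |L f| > e, and then, by [PC_cutoff], f = 0
on all of c with |L f| >= e / 2: this contradicts [PC_vanishing]. *)
Lemma PC_atomic (L : dual Y) (e : K) : wstar_weak_PC L -> 0 < e ->
  exists c : seq (iso_point Omega), forall f : Y, `|f| <= 1 ->
    (forall p, p \in c -> f (val p) = 0) -> `|L f| <= e.
Proof.
move=> PCL e0; apply: contrapT => noc.
have e2 : 0 < e / 2 by rewrite divr_gt0.
pose B (c : seq Omega) := [set f : Y |
  [/\ `|f| <= 1, forall w, w \in c -> f w = 0 & e / 2 <= `|L f|]].
have PG : ProperFilter (filter_from setT B).
  apply: filter_from_proper.
    apply: filter_fromT_filter; first by exists [::].
    move=> c c'; exists (c ++ c') => f [f1 fc Lf].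
    by split; split => // w wc; apply: fc; rewrite mem_cat wc ?orbT.
  move=> c _.
  pose ci : seq (iso_point Omega) := pmap insub c.
  have [f [f1 fc Lf]] : exists f : Y, [/\ `|f| <= 1,
      forall p, p \in ci -> f (val p) = 0 & e < `|L f|].
    apply: contrapT => nof; apply: noc; exists ci => f f1 fci.
    rewrite real_leNgt ?normr_real ?gtr0_real//; apply/negP => Lf.
    by apply: nof; exists f.
  pose cn := [seq w <- c | ~~ `[< isolated [set: Omega] w >]].
  have [|g [g1 gc fg Lg]] := PC_cutoff (c := cn) PCL _ f1 e2.
    by move=> w; rewrite mem_filter => /andP[/asboolPn].
  exists g; split=> //.
    move=> w wc; have [iw|niw] := boolP `[< isolated [set: Omega] w >].
      apply: fg; apply: (fc (exist _ w iw)).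
      by rewrite mem_pmap_sub.
    by apply: gc; rewrite mem_filter niw.
  by move: Lg; rewrite -lerBlDr; apply: le_trans; rewrite lerBrDr -splitr ltW.
have dT : dense [set: Omega] by move=> O [t Ot] _; exists t.
apply: (PC_vanishing PCL dT PG _ _ e2).
- by exists [::] => // f [].
- by move=> w _; exists [:: w] => // f [_ + _]; apply; rewrite mem_head.
- by exists [::] => // f [].
Qed.

Lemma delta_norm (w : Omega) (xs : dual X) : `|delta_tensor cptO w xs| <= `|xs|.
Proof.
apply: dual_norm_le => // f f1; rewrite delta_tensorE ler_dual1//.
exact: le_trans (Cfun_ler _ _) f1.
Qed.

(** Let y tend weak* to the normalised atom m / |m| inside the ball of the dual of
X.  Replacing the atom of L by |m| y gives T y, which stays in the ball by
[peel_norm] and tends weak* to L.  Evaluate at the bidual element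
mu |-> Phi (atom mu). *)
Lemma PC_atom (L : dual Y) (p : iso_point Omega) : wstar_weak_PC L ->
  atom hausO L p != 0 ->
  wstar_weak_PC (`|atom hausO L p|^-1 *: atom hausO L p).
Proof.
set m := atom _ _ _ => PCL m0.
have a0 : 0 < `|m| by rewrite normr_gt0.
have a_neq0 : `|m| != 0 by rewrite gt_eqF.
have /wstar_weak_PC_cvg[L1 cvgL] := PCL.
apply/wstar_weak_PC_cvg; split.
  by rewrite normrZ normfV normr_id mulVf.
move=> H FH H1 Hm Phi.
(* L0 is L deprived of its atom at p. *)
pose L0 : dual Y := L - 1 *: delta_tensor cptO (val p) m.
pose T (y : dual X) : dual Y := L0 + `|m| *: delta_tensor cptO (val p) y.
have [|||phi phiE _] := @bounded_functional K (dual Y)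
    (fun mu => Phi (atom hausO mu p)) `|Phi|.
- by [].
- move=> a mu nu; rewrite -linearP; congr (Phi _); apply: dual_eq => x.
  rewrite atomE.
  by rewrite [RHS](_ : _ = a *: atom hausO mu p x + atom hausO nu p x)// !atomE.
- move=> mu; rewrite (le_trans (ler_dual _ _))// ler_wpM2l//.
  apply: dual_norm_le => // x x1; rewrite atomE ler_dual1//.
  exact: le_trans (spike_norm _ _ _ _) x1.
have phi_delta y : phi (delta_tensor cptO (val p) y) = Phi y.
  by rewrite phiE atom_delta eqxx.
have Tm : T (`|m|^-1 *: m) = L.
  apply: dual_eq => f; rewrite /T /L0 scale1r.
  rewrite [LHS](_ : _ = L f - m (f (val p)) + `|m| *: (`|m|^-1 *: m (f (val p))))//.
  by rewrite scalerA mulfV// scale1r subrK.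
have phiT y : phi (T y) = phi L0 + `|m| *: Phi y.
  by rewrite linearD linearZ /= phi_delta.
have T1 (y : dual X) : `|y| <= 1 -> `|T y| <= 1.
  move=> y1; have L0m : `|L0| <= `|L| - 1 * `|m|.
    by apply: peel_norm; rewrite ler01 lexx.
  have my : `| `|m| *: delta_tensor cptO (val p) y| <= `|m|.
    rewrite normrZ normr_id -[leRHS]mulr1 ler_wpM2l//.
    exact: le_trans (delta_norm _ _) y1.
  apply: le_trans (ler_normD _ _) _; apply: le_trans (lerD L0m my) _.
  by rewrite mul1r subrK.
have cvgT : (fun mu : dual Y => phi mu : K^o) @ (T @ H) --> (phi L : K^o).
  apply: cvgL; first exact: filterS T1 H1.
  move=> f; rewrite -Tm.
  exact: cvgD (cvg_cst (L0 f : K^o)) (cvgZl_tmp (k := `|m|) (Hm (f (val p)))).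
rewrite (_ : (fun g => Phi g : K^o) =
    (fun y => `|m|^-1 *: (phi (T y) - phi L0))); last first.
  by apply/funext => y; rewrite phiT addrC addKr scalerA mulVf// scale1r.
rewrite [Phi _](_ : _ = `|m|^-1 *: (phi L - phi L0)); last first.
  by rewrite -Tm phiT addrC addKr scalerA mulVf// scale1r.
exact: cvgZl_tmp (cvgB cvgT (cvg_cst _)).
Qed.

End PC_structure.

(** * The norm of a point of continuity *)

Section norm_one.
Context (K : scalarField) (Omega : topologicalType)
  (cptO : compact [set: Omega]) (X : normedModType K)
  (hausO : hausdorff_space Omega).
Local Notation Y := (Cfun cptO X).

Lemma nonisolated_point : infinite_set [set: Omega] ->
  exists w : Omega, ~ isolated [set: Omega] w.
Proof.
move=> infO; apply: contrapT => noniso; apply: infO.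
have [|c _ cT] := compact_finite_cover cptO (D := setT) (A := fun w => [set w]).
  move=> t; exists t => //.
  have [_ [V nV]] : isolated setT t by apply: contrapT => nt; apply: noniso; exists t.
  by rewrite setIT => <-.
apply: (@sub_finite_set _ _ [set` c]); last exact: finite_seq.
by move=> t _; have [w wc /= ->] := cT t.
Qed.

(** If |L| < 1, the functionals L + (delta_w - delta_w0) (x) ys stay in the ball
for small ys and tend to L weak* as w tends to a non-isolated w0.  Along
functions with value x1 at w0 and supported near w0, they differ from L by
- ys x1. *)
Lemma PC_norm1 (L : dual Y) : infinite_set [set: Omega] ->
  (exists x : X, x != 0) -> wstar_weak_PC L -> `|L| = 1.
Proof.
move=> infO [x0 x0_neq0] PCL; have L1 : `|L| <= 1 by case: PCL.
apply/eqP; rewrite eq_le L1 real_leNgt ?normr_real//; apply/negP => L_lt1.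
have [w0 niw] := nonisolated_point infO.
have [xs xsx0] := nonzero_functional x0_neq0.
have nx0 : 0 < `|x0| by rewrite normr_gt0.
have nxs : 0 < `|xs|.
  rewrite normr_gt0; apply: contraNneq xsx0 => ->; exact/eqP.
have [r r0 rE] : exists2 r : K, 0 < r & r + r = 1 - `|L|.
  by exists ((1 - `|L|) / 2); rewrite -?splitr// divr_gt0// subr_gt0.
pose ys : dual X := (r / `|xs|) *: xs.
have ysr : `|ys| = r.
  have rx0 : 0 <= r / `|xs| by rewrite divr_ge0 ?ltW.
  by rewrite normrZ (ger0_norm rx0) divfK ?gt_eqF.
pose x1 := `|x0|^-1 *: x0.
have nx1 : `|x1| = 1 by rewrite normrZ normfV normr_id mulVf// gt_eqF.
have e0 : 0 < `|ys x1|.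
  have -> : ys x1 = (r / `|xs|) * (`|x0|^-1 * xs x0).
    by rewrite [LHS](_ : _ = (r / `|xs|) *: xs x1)// linearZ.
  have r_neq0 : r != 0 by rewrite gt_eqF.
  have nx0' : `|x0|^-1 != 0 by rewrite invr_eq0 gt_eqF.
  have nxs' : `|xs|^-1 != 0 by rewrite invr_eq0 gt_eqF.
  by rewrite normr_gt0 mulf_neq0 ?mulf_neq0.
pose mu w : dual Y := L + (delta_tensor cptO w ys - delta_tensor cptO w0 ys).
have PN : ProperFilter (within (~` [set w0]) (nbhs w0)).
  apply: Build_ProperFilter_ex => P; rewrite /within /= nbhsE => -[U [oU Uw0] UP].
  have [|w [Uw ww0]] := dense_setC1 niw _ oU; first by exists w0.
  by exists w; exact: UP.
pose B (U : set Omega) := [set f : Y |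
  [/\ `|f| <= 1, f w0 = x1 & forall w, ~ U w -> f w = 0]].
have PG : ProperFilter (filter_from (nbhs w0) B).
  apply: filter_from_proper.
    apply: filter_from_filter; first by exists setT; exact: filterT.
    move=> U V nU nV; exists (U `&` V); first exact: filterI.
    by move=> f [f1 fw0 fUV]; split; split => // w nUw; apply: fUV => -[].
  move=> U nU; have [b [cb b01 bw bU]] := bump K cptO hausO nU.
  have cbx : continuous (fun t => b t *: x1).
    by move=> t; apply: cvgZ; [exact: cb|exact: cvg_cst].
  have bE t : mkCfun cptO cbx t = b t *: x1 by [].
  exists (mkCfun cptO cbx); split=> [||w /bU bw0].
  - apply: Cfun_norm_le => // t; rewrite bE normrZ nx1 mulr1.
    by have /andP[b0 b1] := b01 t; rewrite ger0_norm.
  - by rewrite bE bw scale1r.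
  - by rewrite bE bw0 scale0r.
apply: (PC_double_limit (H := mu @ within (~` [set w0]) (nbhs w0)) PCL PG _ _ _ _ e0).
- by exists setT; [exact: filterT|move=> f []].
- apply: nearW => w /=; rewrite (le_trans (ler_normD _ _))//.
  rewrite -lerBrDl (le_trans (ler_normB _ _))//.
  by rewrite -rE lerD// -ysr delta_norm.
- move=> f.
  have cf : (fun w => ys (f w) : K^o) @ w0 --> (ys (f w0) : K^o).
    apply: (@continuous_comp _ _ _ f ys); first exact: Cfun_continuous.
    exact: dual_continuous.
  have := cvgD (cvg_cst (L f : K^o)) (cvgB cf (cvg_cst (ys (f w0) : K^o))).
  rewrite subrr addr0 => cmu A /cmu.
  change (nbhs w0 [set w | A (mu w f)] ->
    nbhs w0 [set w | (~` [set w0]) w -> A (mu w f)]).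
  by apply: filterS => w Aw _.
- change (nbhs w0 [set w | (~` [set w0]) w ->
    filter_from (nbhs w0) B [set f : Y | `|ys x1| <= `|mu w f - L f|]]).
  apply: nearW => w ww0.
  exists (~` [set w]).
    apply: open_nbhs_nbhs; split; last by move=> w0w; exact: ww0.
    exact/closed_openC/accessible_closed_set1/hausdorff_accessible.
  move=> f [_ fw0 fw]; change (`|ys x1| <= `|mu w f - L f|).
  have -> : mu w f - L f = - ys x1; last by rewrite normrN.
  rewrite [LHS](_ : _ = L f + (ys (f w) - ys (f w0)) - L f)//.
  by rewrite addrAC subrr add0r fw0 fw ?linear0 ?sub0r//; apply.
Qed.

End norm_one.

(** * Peeling off atoms *)

Section peeling.
Context (K : scalarField) (Omega : topologicalType)
  (cptO : compact [set: Omega]) (X : normedModType K)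
  (hausO : hausdorff_space Omega).
Local Notation Y := (Cfun cptO X).
Local Notation iso := (iso_point Omega).
Local Notation spike := (spike cptO hausO).
Implicit Types (M : dual Y) (c : seq iso) (p q : iso).

Lemma subr_half (V : lmodType K) (v : V) : v - 2^-1 *: v = 2^-1 *: v.
Proof.
rewrite -[X in X - _]scale1r -scalerBl; congr (_ *: _).
by rewrite [X in X - _]splitr mul1r addrK.
Qed.

(** The mass of M off the finite set c is at most e. *)
Definition concentrated M c (e : K) := forall f : Y, `|f| <= 1 ->
  (forall p, p \in c -> f (val p) = 0) -> `|M f| <= e.

(** Remove from f its values at the points of c, one point at a time: each removal
changes M f by at most the norm of the corresponding atom. *)
Lemma concentrated_norm_le M c e : concentrated M c e ->
  `|M| <= e + \sum_(p <- c) `|atom hausO M p|.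
Proof.
move=> Me.
have cut (f : Y) : `|f| <= 1 -> forall c', exists g : Y,
    [/\ `|g| <= 1, forall p, p \in c' -> g (val p) = 0 &
       `|M f| <= `|M g| + \sum_(p <- c') `|atom hausO M p|].
  move=> f1; elim=> [|p c' [g [g1 gc Mg]]].
    by exists f; rewrite big_nil addr0.
  have gpE t : (g - spike p (g (val p))) t = if t == val p then 0 else g t.
    rewrite [LHS](_ : _ = g t - spike p (g (val p)) t)// spikeE.
    by case: eqP => [->|]; rewrite ?subrr ?subr0.
  exists (g - spike p (g (val p))); split.
  - apply: Cfun_norm_le => // t; rewrite gpE; case: ifP; rewrite ?normr0// => _.
    exact: le_trans (Cfun_ler _ _) g1.
  - by move=> q; rewrite inE gpE val_eqE => /orP[->|/gc ->]//; case: ifP.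
  - rewrite big_cons addrA (le_trans Mg)// lerD2r.
    have -> : M g = M (g - spike p (g (val p))) + atom hausO M p (g (val p)).
      by rewrite linearB /= atomE subrK.
    rewrite (le_trans (ler_normD _ _))// lerD2l ler_dual1//.
    exact: le_trans (Cfun_ler _ _) g1.
have e0 : 0 <= e.
  by rewrite (le_trans _ (Me 0 _ _))// ?normr0.
apply: dual_norm_le => [|f f1]; first by rewrite addr_ge0// sumr_ge0.
have [g [g1 gc /le_trans]] := cut f f1 c; apply.
by rewrite lerD2r Me.
Qed.

(** Half of the atom is removed, and not all of it, so that no atom ever becomes
zero. *)
Definition peel M p : dual Y :=
  M - 2^-1 *: delta_tensor cptO (val p) (atom hausO M p).

(** peel M p f is M g, where g is f with its value at p halved. *)
Lemma concentrated_peel M c e p :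
  concentrated M c e -> concentrated (peel M p) c e.
Proof.
move=> Me f f1 fc; pose g := f - 2^-1 *: spike p (f (val p)).
have gE t : g t = if t == val p then 2^-1 *: f t else f t.
  rewrite [LHS](_ : _ = f t - 2^-1 *: spike p (f (val p)) t)// spikeE.
  case: eqP => [->|]; last by rewrite scaler0 subr0.
  exact: subr_half.
have -> : peel M p f = M g.
  rewrite /g linearB linearZ /= -atomE.
  by rewrite [LHS](_ : _ = M f - 2^-1 *: atom hausO M p (f (val p))).
have half : `|2^-1 : K| <= 1 by rewrite ger0_norm ?invr_ge0// invf_le1// ler1n.
apply: Me => [|q qc].
  apply: Cfun_norm_le => // t; rewrite gE; have ft := le_trans (Cfun_ler f t) f1.
  by case: ifP => // _; rewrite normrZ mulr_ile1.
by rewrite gE fc// scaler0; case: ifP.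
Qed.

Lemma atom_peel M p q :
  atom hausO (peel M p) q = (if p == q then 2^-1 else 1) *: atom hausO M q.
Proof.
rewrite atomB atom_delta; case: eqP => [->|_]; last by rewrite scaler0 subr0 scale1r.
exact: subr_half.
Qed.

Definition heaviest M p := 0 < `|atom hausO M p| /\
  forall q, `|atom hausO M q| <= `|atom hausO M p|.

(** K is only partially ordered, but its nonnegative elements are comparable. *)
Lemma seq_argmax (T : eqType) (F : T -> K) (x : T) (s : seq T) :
  (forall y, 0 <= F y) ->
  exists2 y, y \in x :: s & forall z, z \in x :: s -> F z <= F y.
Proof.
move=> F0; elim: s x => [|y s IH] x.
  by exists x; rewrite ?mem_head// => z; rewrite inE => /eqP ->.
have [z zys zmax] := IH y.
have [zx|xz] := real_leP (ger0_real (F0 z)) (ger0_real (F0 x)).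
  exists x; first exact: mem_head.
  move=> t; rewrite inE => /orP[/eqP ->//|/zmax tz]; exact: le_trans tz zx.
exists z; first by rewrite inE zys orbT.
by move=> t; rewrite inE => /orP[/eqP ->|/zmax//]; exact: ltW.
Qed.

(** Off a finite set all atoms have norm at most half that of a given nonzero one,
so the supremum of the norms of the atoms is attained. *)
Lemma heaviest_exists M : M != 0 ->
  (forall e, 0 < e -> exists c, concentrated M c e) -> exists p, heaviest M p.
Proof.
move=> M0 Matomic; have nM : 0 < `|M| by rewrite normr_gt0.
have nM2 : 0 < `|M| / 2 by rewrite divr_gt0.
have [p0 p00] : exists p0, 0 < `|atom hausO M p0|.
  have [c Mc] := Matomic _ nM2; apply: contrapT => noatom.
  have := concentrated_norm_le Mc; rewrite big1 => [|p _]; last first.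
    apply/eqP; rewrite -normr_le0 normr_id real_leNgt ?normr_real//.
    by apply/negP => p_gt0; apply: noatom; exists p.
  by rewrite addr0 [X in X <= _]splitr gerDl => /(lt_le_trans nM2); rewrite ltxx.
have [c Mc] := Matomic _ (divr_gt0 p00 (ltr0n _ 2)).
have [p pc pmax] :=
  @seq_argmax _ (fun q => `|atom hausO M q|) p0 c (fun q => normr_ge0 _).
have p0p : `|atom hausO M p0| <= `|atom hausO M p| by apply: pmax; rewrite mem_head.
exists p; split; first exact: lt_le_trans p0p.
move=> q; have [qc|qc] := boolP (q \in c); first by apply: pmax; rewrite inE qc orbT.
apply: le_trans p0p; apply: (@le_trans _ _ (`|atom hausO M p0| / 2)); last first.
  by rewrite ler_pdivrMr// mulr2n mulrDr mulr1 lerDl.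
apply: dual_norm_le => [|x x1]; first by rewrite divr_ge0.
rewrite atomE; apply: Mc; first exact: le_trans (spike_norm _ _ _ _) x1.
by move=> r rc; rewrite spikeE; case: eqP => // /val_inj rq; rewrite -rq rc in qc.
Qed.

End peeling.

(* In the order of K, 0 < alpha i <= 1 forces alpha i to be real.             *)
Theorem theorem3p4 (K : scalarField) (Omega : topologicalType)
    (cptO : compact [set: Omega]) (hausO : hausdorff_space Omega)
    (infO : infinite_set [set: Omega])
    (X : completeNormedModType K) (X_neq0 : exists x : X, x != 0)
    (Lambda : dual (Cfun cptO X)) (PC_Lambda : wstar_weak_PC Lambda) :
  exists (alpha : nat -> K) (omega : nat -> Omega) (xs : nat -> dual X),
    [/\ forall i, 0 < alpha i <= 1,
        series alpha @ \oo --> (1 : K),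
        forall i, wstar_weak_PC (xs i),
        forall i, isolated [set: Omega] (omega i) &
        series (fun i => alpha i *: delta_tensor cptO (omega i) (xs i)) @ \oo
          --> Lambda].
Proof.
have L1 := PC_norm1 hausO infO X_neq0 PC_Lambda.
have L_neq0 : Lambda != 0 by rewrite -normr_gt0 L1.
have Latomic e : 0 < e -> exists c, concentrated Lambda c e :=
  PC_atomic hausO PC_Lambda.
have [p0 [p0_gt0 _]] := heaviest_exists hausO L_neq0 Latomic.
(* p0 is a default value: every M n has a heaviest atom, by pickM below. *)
pose pick (N : dual (Cfun cptO X)) := xget p0 (heaviest hausO N).
pose M n := iter n (fun N => peel hausO N (pick N)) Lambda.
have atomM n p : exists2 c : K, 0 < c & atom hausO (M n) p = c *: atom hausO Lambda p.
  elim: n => [|n [c c0 IH]]; first by exists 1; rewrite ?scale1r.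
  rewrite /M iterS -/(M n) atom_peel IH scalerA; eexists; last by [].
  by rewrite mulr_gt0//; case: ifP; rewrite ?invr_gt0.
have concM n c e : concentrated Lambda c e -> concentrated (M n) c e.
  by move=> Le; elim: n => //= n IH; exact: concentrated_peel.
have pickM n : heaviest hausO (M n) (pick (M n)).
  rewrite /pick; case: xgetP => [p _ //|nop]; exfalso.
  have [|e e0|p /nop//] := heaviest_exists hausO (M := M n).
    have [c c0 Mp] := atomM n p0.
    apply/eqP => Mn0; move: p0_gt0.
    have : c *: atom hausO Lambda p0 = 0.
      by rewrite -Mp Mn0; apply: dual_eq => x; rewrite atomE.
    by move/eqP; rewrite scaler_eq0 gt_eqF//= => /eqP ->; rewrite normr0 ltxx.
  by have [c /concM Mc] := Latomic e e0; exists c.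
pose a n := atom hausO (M n) (pick (M n)).
have a_gt0 n : 0 < `|a n| by case: (pickM n).
pose alpha n := 2^-1 * `|a n|.
have alpha_gt0 n : 0 < alpha n by rewrite mulr_gt0// invr_gt0.
pose xs n := `|a n|^-1 *: a n.
have MS n : M n.+1 = M n - alpha n *: delta_tensor cptO (val (pick (M n))) (xs n).
  apply: dual_eq => f; rewrite /M iterS -/(M n).
  rewrite [LHS](_ : _ = M n f - 2^-1 *: a n (f (val (pick (M n)))))//.
  rewrite [RHS](_ : _ = M n f - alpha n *: (`|a n|^-1 *: a n (f (val (pick (M n))))))//.
  by rewrite scalerA /alpha -mulrA mulfV ?mulr1// gt_eqF.
have telescope n :
  series (fun i => alpha i *: delta_tensor cptO (val (pick (M i))) (xs i)) n =
  Lambda - M n.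
  elim: n => [|n IH]; first by rewrite /series /= big_geq// subrr.
  by rewrite seriesSr IH MS opprB addrA addrAC.
have M_step n : `|M n.+1| <= `|M n| - alpha n.
  by apply: peel_norm; rewrite invr_ge0 ler0n /= invf_le1// ler1n.
have norm_le n : `|M n| + series alpha n <= 1.
  elim: n => [|n IH]; first by rewrite /series /= big_geq// addr0 L1.
  apply: le_trans IH; rewrite seriesSr addrCA addrC lerD2r.
  by rewrite -lerBrDr.
have norm_ge n : 1 <= `|M n| + series alpha n.
  rewrite -L1 -{1}(subrK (M n) Lambda) -telescope addrC.
  rewrite (le_trans (ler_normD _ _))// lerD2l.
  rewrite (le_trans (ler_norm_sum _ _ _))//; apply: ler_sum => i _.
  rewrite normrZ gtr0_norm// -[leRHS]mulr1 (ler_wpM2l (ltW (alpha_gt0 i)))//.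
  apply: le_trans (delta_norm cptO _ _) _.
  by rewrite normrZ normfV normr_id mulVf ?gt_eqF.
have norm_eq n : 1 - series alpha n = `|M n|.
  by apply/eqP; rewrite eq_le lerBlDr norm_ge lerBrDr norm_le.
have M_mono m n : (m <= n)%N -> `|M n| <= `|M m|.
  move=> /subnKC <-; elim: (n - m)%N => [|k IH]; first by rewrite addn0.
  rewrite addnS (le_trans (M_step _))// (le_trans _ IH)// gerBl.
  exact: ltW.
(* The partial sums of alpha are bounded by 1. *)
have alpha_small e : 0 < e -> exists n, alpha n < e.
  move=> e0; apply: contrapT => noalpha.
  have alpha_ge n : e <= alpha n.
    rewrite real_leNgt ?gtr0_real//; apply/negP => ne.
    by apply: noalpha; exists n.
  have [n] := scalar_archimedean e0; rewrite -div1r ltr_pdivrMr// => ne.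
  have sum_ge : e *+ n.+1 <= series alpha n.+1.
    by rewrite -[n.+1 in leLHS]subn0 -sumr_const_nat; apply: ler_sum.
  have : e *+ n.+1 <= 1.
    by rewrite (le_trans sum_ge)// (le_trans _ (norm_le n.+1))// lerDr.
  by rewrite -mulr_natr => /(lt_le_trans ne); rewrite ltxx.
(* All atoms of M n have norm at most 2 * alpha n, and the finite set c that
   carries Lambda up to e / 2 also carries M n up to e / 2. *)
have M_small e : 0 < e -> exists n, `|M n| < e.
  move=> e0; have e2 : 0 < e / 2 by rewrite divr_gt0.
  have [c Lc] := Latomic _ e2.
  have s0 : 0 < (2 * (size c).+1%:R : K) by rewrite mulr_gt0.
  have [n] := alpha_small _ (divr_gt0 e2 s0).
  rewrite ltr_pdivlMr// => an; exists n.
  apply: (le_lt_trans (concentrated_norm_le hausO (concM n _ _ Lc))).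
  rewrite [ltRHS]splitr ltrD2l (le_lt_trans _ an)//.
  have aE : `|a n| = 2 * alpha n by rewrite /alpha mulrA mulfV ?mul1r.
  apply: (@le_trans _ _ (\sum_(p <- c) `|a n|)).
    by apply: ler_sum => p _; case: (pickM n).
  rewrite big_const_seq count_predT iter_addr_0 aE -[leLHS]mulr_natr -mulrA mulrCA.
  by rewrite (ler_wpM2l (ltW (alpha_gt0 n)))// ler_wpM2l// ler_nat.
have M_near e : 0 < e -> \forall n \near \oo, `|M n| < e.
  move=> /M_small[n Mn]; exists n => // m /= nm; exact: le_lt_trans (M_mono _ _ nm) Mn.
exists alpha, (fun n => val (pick (M n))), xs; split.
- move=> n; rewrite alpha_gt0 /=; apply: le_trans (norm_le n.+1).
  rewrite seriesSr addrA lerDr addr_ge0// sumr_ge0// => i _; exact: ltW.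
- apply/cvgrPdist_lt => e /M_near; apply: filterS => n.
  by rewrite norm_eq normr_id.
- move=> n; rewrite /xs; have [c c0 aE] := atomM n (pick (M n)).
  have aL : atom hausO Lambda (pick (M n)) != 0.
    by apply: contraTneq (a_gt0 n) => aL0; rewrite /a aE aL0 scaler0 normr0 ltxx.
  have -> : `|a n|^-1 *: a n =
      `|atom hausO Lambda (pick (M n))|^-1 *: atom hausO Lambda (pick (M n)).
    rewrite /a aE normrZ gtr0_norm// scalerA invfM mulrAC mulVf ?mul1r//.
    by rewrite gt_eqF.
  exact: PC_atom.
- by move=> n; exact: isoP.
- apply/cvgrPdist_lt => e /M_near; apply: filterS => n.
  by rewrite telescope opprB addrC subrK.
Qed.
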